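(* Let $\mathsf G$ and $\mathsf H$ be topological groupoids. Suppose that $G^0$ is a regular topological space. Then $\mathsf{OFMor}(\mathsf G,\mathsf H)$, with the topology described in the context, is a topological groupoid.
   Context: A groupoid $\mathsf G=(G^1\rightrightarrows G^0)$ is a small category all of whose arrows are invertible, with source and target $s,t:G^1\to G^0$; composition is written from left to right ($x\cdot y:a\to c$ for $x:a\to b$, $y:b\to c$). It is a topological groupoid if $G^0,G^1$ are topological spaces and all structure maps (source, target, multiplication, unit, inverse) are continuous. Strict morphisms $\mathsf f=(f^0,f^1)$ of topological groupoids are continuous functors; natural transformations $\alpha:\mathsf f\Rightarrow\mathsf g:\mathsf K\to\mathsf H$ are continuous maps $\alpha:K^0\to H^1$ with $\alpha(a):f^0(a)\to g^0(a)$ and $f^1(x)\cdot\alpha(b)=\alpha(a)\cdot g^1(x)$ for $x:a\to b$. For spaces $X,Y$, $C(X,Y)$ is the space of continuous maps with the compact-open topology. $\mathsf{SMor}(\mathsf K,\mathsf H)$: $\mathrm{SMor}^0(\mathsf K,\mathsf H)$ is the set of continuous strict morphisms $\mathsf K\to\mathsf H$, topologized as a subspace of $C(K^0,H^0)\times C(K^1,H^1)$; $\mathrm{SMor}^1(\mathsf K,\mathsf H)$ is the set of continuous natural transformations between them (a natural transformation being recorded as the pair of its source strict morphism and its map $K^0\to H^1$), topologized as a subspace of $\mathrm{SMor}^0(\mathsf K,\mathsf H)\times C(K^0,H^1)$. $S,T:\mathrm{SMor}^1\to\mathrm{SMor}^0$ are source and target. A full-equivalence $\psi:\mathsf K\to\mathsf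 G$ (a strict morphism that is full and faithful with $\psi^0$ surjective) is an open refinement if $K^0$ is a disjoint union of open subsets of $G^0$ and $\mathsf K$ is the pull-back groupoid along the natural map $K^0\to G^0$, with $\psi$ the corresponding strict morphism. The strict fiber product $\mathsf K\stackrel{\circ}{\times}_{\mathsf G}\mathsf W$ of $\psi:\mathsf K\to\mathsf G$ and $\phi:\mathsf W\to\mathsf G$ has objects $\{(k,w):\psi^0(k)=\phi^0(w)\}$ and arrows $\{(x,y):\psi^1(x)=\phi^1(y)\}$, with projections $\pi_1,\pi_2$ to $\mathsf K,\mathsf W$. $\mathsf{OFMor}(\mathsf G,\mathsf H)$ is the groupoid with objects $\mathrm{OFMor}^0(\mathsf G,\mathsf H)=\bigsqcup_{\psi:\mathsf K\to\mathsf G\text{ open refinement}}\mathrm{SMor}^0(\mathsf K,\mathsf H)$, i.e. triples $(\psi,\mathsf K,\mathsf u)$. An arrow $(\psi,\mathsf K,\mathsf u)\to(\phi,\mathsf W,\mathsf w)$ is a natural transformation $\mathsf u\circ\pi_1\Rightarrow\mathsf w\circ\pi_2:\mathsf K\stackrel{\circ}{\times}_{\mathsf G}\mathsf W\to\mathsf H$. The composition of $\alpha:(\psi,\mathsf K,\mathsf u)\to(\phi,\mathsf W,\mathsf w)$ and $\beta:(\phi,\mathsf W,\mathsf w)\to(\varphi,\mathsf V,\mathsf v)$ is $(\alpha\,\tilde\bullet\,\beta)(k,v)=\alpha(k,w)\cdot\beta(w,v)$ for any $w\in W^0$ with $\phi^0(w)=\psi^0(k)=\varphi^0(v)$. Topology: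 $\mathrm{OFMor}^0(\mathsf G,\mathsf H)$ has the disjoint union topology. For open refinements $\psi:\mathsf K\to\mathsf G$, $\phi:\mathsf W\to\mathsf G$, the set of arrows from the component $\mathrm{SMor}^0(\mathsf K,\mathsf H)$ to the component $\mathrm{SMor}^0(\mathsf W,\mathsf H)$ is the fiber product $$\mathrm{OFMor}^1(\psi,\phi)=\mathrm{SMor}^0(\mathsf K,\mathsf H)\times_{\pi_1^*,S}\mathrm{SMor}^1(\mathsf K\stackrel{\circ}{\times}_{\mathsf G}\mathsf W,\mathsf H)\times_{T,\pi_2^*}\mathrm{SMor}^0(\mathsf W,\mathsf H)$$ over $\mathrm{SMor}^0(\mathsf K\stackrel{\circ}{\times}_{\mathsf G}\mathsf W,\mathsf H)$, where $\pi_i^*$ is precomposition with $\pi_i$; it has the fiber product topology, and $\mathrm{OFMor}^1(\mathsf G,\mathsf H)=\bigsqcup_{\psi,\phi}\mathrm{OFMor}^1(\psi,\phi)$ has the disjoint union topology. *)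

(* Defs.v *)
From HB Require Import structures.
From mathcomp Require Import all_boot all_classical topology.

Set Implicit Arguments.
Unset Strict Implicit.
Unset Printing Implicit Defensive.

Local Open Scope classical_set_scope.

Import ArrowAsCompactOpen.

(* The multiplication is a total function [m x y] whose value is meaningful
   only on the composable pairs, those with [t x = s y]; it is written in
   diagrammatic order. *)
Record is_topological_groupoid (O A : topologicalType) (s t : A -> O)
    (m : A -> A -> A) (e : O -> A) (i : A -> A) : Prop := {
  tg_src_mul : forall x y, t x = s y -> s (m x y) = s x ;
  tg_tgt_mul : forall x y, t x = s y -> t (m x y) = t y ;
  tg_mulA : forall x y z, t x = s y -> t y = s z ->
    m x (m y z) = m (m x y) z ;
  tg_src_unit : forall a, s (e a) = a ;
  tg_tgt_unit : forall a, t (e a) = a ;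
  tg_mul1x : forall x, m (e (s x)) x = x ;
  tg_mulx1 : forall x, m x (e (t x)) = x ;
  tg_src_inv : forall x, s (i x) = t x ;
  tg_tgt_inv : forall x, t (i x) = s x ;
  tg_mulxV : forall x, m x (i x) = e (s x) ;
  tg_mulVx : forall x, m (i x) x = e (t x) ;
  tg_src_continuous : continuous s ;
  tg_tgt_continuous : continuous t ;
  tg_mul_continuous :
    {within [set p : A * A | t p.1 = s p.2], continuous (fun p => m p.1 p.2)} ;
  tg_unit_continuous : continuous e ;
  tg_inv_continuous : continuous i
}.

Record topological_groupoid := TopologicalGroupoid {
  ob : topologicalType ;
  arr : topologicalType ;
  src : arr -> ob ;
  tgt : arr -> ob ;
  mul : arr -> arr -> arr ;
  unit : ob -> arr ;
  inv : arr -> arr ;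
  groupoidP : is_topological_groupoid src tgt mul unit inv
}.

Arguments src {t} _.
Arguments tgt {t} _.
Arguments mul {t} _ _.
Arguments unit {t} _.
Arguments inv {t} _.
Arguments groupoidP : clear implicits.

Section continuity.

Lemma continuous_pair (X Y Z : topologicalType) (f : X -> Y) (g : X -> Z) :
  continuous f -> continuous g -> continuous (fun x => (f x, g x)).
Proof. by move=> cf cg x; apply: cvg_pair; [exact: cf|exact: cg]. Qed.

Lemma continuous_compose (X Y Z : topologicalType) (f : X -> Y) (g : Y -> Z) :
  continuous f -> continuous g -> continuous (fun x => g (f x)).
Proof. by move=> cf cg x; apply: (@continuous_comp _ _ _ f g); [exact: cf|exact: cg]. Qed.

Lemma continuous_fst (X Y : topologicalType) : continuous (@fst X Y).
Proof. by move=> x; exact: cvg_fst. Qed.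

Lemma continuous_snd (X Y : topologicalType) : continuous (@snd X Y).
Proof. by move=> x; exact: cvg_snd. Qed.

Lemma continuous_val (X : topologicalType) (B : set X) :
  continuous (fun b : B => val b).
Proof. exact: (@initial_continuous B X set_val). Qed.

Lemma continuous_into (X Y : topologicalType) (B : set Y) (f : X -> B) :
  continuous (fun x => val (f x)) -> continuous f.
Proof. by move=> cf; apply: continuous_comp_initial; exact: cf. Qed.

Lemma within_compose (X Y Z : topologicalType) (A : set X) (B : set Y)
    (f : X -> Y) (g : Y -> Z) :
  (forall x, A x -> B (f x)) -> continuous f ->
  {within B, continuous g} -> {within A, continuous (fun x => g (f x))}.
Proof.
move=> AB cf /subspace_sigL_continuousP cg; apply/subspace_sigL_continuousP.
have mAB (a : A) : f (val a) \in B by apply/mem_set/AB/set_mem/(valP a).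
apply: (@continuous_compose _ _ _ (fun a : A => SigSub (mAB a) : B) _ _ cg).
apply: continuous_into => /=.
exact: continuous_compose (@continuous_val _ A) cf.
Qed.

Definition set_insubd (Y : Type) (B : set Y) (d : B) (y : Y) : B := insubd d y.

Lemma set_insubdK (Y : Type) (B : set Y) (d : B) (y : Y) :
  B y -> val (set_insubd d y) = y.
Proof. by move=> By; rewrite insubdK//; exact/mem_set. Qed.

Lemma within_insubd (X Y : topologicalType) (A : set X) (B : set Y)
    (d : X -> B) (f : X -> Y) :
  (forall x, A x -> B (f x)) -> {within A, continuous f} ->
  {within A, continuous (fun x => set_insubd (d x) (f x))}.
Proof.
move=> AB /subspace_sigL_continuousP cf; apply/subspace_sigL_continuousP.
apply: continuous_into => /=.
rewrite (_ : (fun a : A => _) = sigL A f) //.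
apply/funext => a; rewrite /sigL /= set_insubdK//.
exact/AB/set_mem/(valP a).
Qed.

Lemma within_pair (X Y Z : topologicalType) (A : set X) (f : X -> Y) (g : X -> Z) :
  {within A, continuous f} -> {within A, continuous g} ->
  {within A, continuous (fun x => (f x, g x))}.
Proof. by move=> cf cg x; apply: cvg_pair; [exact: cf|exact: cg]. Qed.

End continuity.

Section pullback_groupoid.
Variables (G : topological_groupoid) (X : topologicalType) (f : X -> ob G).
Hypothesis cf : continuous f.

Definition pullback_arr : set (X * arr G * X) :=
  [set p | src p.1.2 = f p.1.1 /\ tgt p.1.2 = f p.2].

Definition pullback_src (p : pullback_arr) : X := (val p).1.1.
Definition pullback_tgt (p : pullback_arr) : X := (val p).2.

(* The value off the composable pairs is the irrelevant default [p]. *)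
Definition pullback_mul (p q : pullback_arr) : pullback_arr :=
  set_insubd p ((val p).1.1, mul (val p).1.2 (val q).1.2, (val q).2).

Lemma pullback_unit_subproof x : pullback_arr (x, unit (f x), x).
Proof.
by split => /=; rewrite ?(tg_src_unit (groupoidP G)) ?(tg_tgt_unit (groupoidP G)).
Qed.

Definition pullback_unit (x : X) : pullback_arr :=
  SigSub (mem_set (pullback_unit_subproof x)).

Lemma pullback_inv_subproof (p : pullback_arr) :
  pullback_arr ((val p).2, inv (val p).1.2, (val p).1.1).
Proof.
have [ps pt] := set_mem (valP p).
by split => /=; rewrite ?(tg_src_inv (groupoidP G)) ?(tg_tgt_inv (groupoidP G)).
Qed.

Definition pullback_inv (p : pullback_arr) : pullback_arr :=
  SigSub (mem_set (pullback_inv_subproof p)).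

Lemma pullback_composable (p q : pullback_arr) :
  pullback_tgt p = pullback_src q -> tgt (val p).1.2 = src (val q).1.2.
Proof.
rewrite /pullback_tgt /pullback_src => pq.
have [_ ->] := set_mem (valP p); have [-> _] := set_mem (valP q).
by rewrite pq.
Qed.

Lemma pullback_mulE (p q : pullback_arr) : pullback_tgt p = pullback_src q ->
  val (pullback_mul p q) = ((val p).1.1, mul (val p).1.2 (val q).1.2, (val q).2).
Proof.
move=> /pullback_composable pq; rewrite /pullback_mul set_insubdK//.
have [ps pt] := set_mem (valP p); have [qs qt] := set_mem (valP q).
split => /=; first by rewrite (tg_src_mul (groupoidP G)).
by rewrite (tg_tgt_mul (groupoidP G)).
Qed.

Lemma pullback_groupoidP : is_topological_groupoid
  pullback_src pullback_tgt pullback_mul pullback_unit pullback_inv.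
Proof.
have gP := groupoidP G.
have cv : continuous (fun p : pullback_arr => val p) by exact: continuous_val.
have c11 : continuous (fun p : pullback_arr => (val p).1.1).
  by do 2 apply: continuous_compose (@continuous_fst _ _).
have c12 : continuous (fun p : pullback_arr => (val p).1.2).
  apply: continuous_compose (@continuous_snd _ _).
  exact: continuous_compose (@continuous_fst _ _).
have c2 : continuous (fun p : pullback_arr => (val p).2).
  exact: continuous_compose (@continuous_snd _ _).
split => //.
- by move=> p q pq; rewrite /pullback_src pullback_mulE.
- by move=> p q pq; rewrite /pullback_tgt pullback_mulE.
- move=> p q r pq qr; apply: val_inj.
  have pqr : pullback_tgt p = pullback_src (pullback_mul q r).
    by rewrite /pullback_src pullback_mulE.
  have pqr' : pullback_tgt (pullback_mul p q) = pullback_src r.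
    by rewrite /pullback_tgt pullback_mulE.
  rewrite !pullback_mulE//= (tg_mulA gP)//; exact: pullback_composable.
- move=> p; apply: val_inj; rewrite pullback_mulE//=.
  have [ps pt] := set_mem (valP p).
  rewrite /pullback_src -ps (tg_mul1x gP).
  by rewrite -!surjective_pairing.
- move=> p; apply: val_inj; rewrite pullback_mulE//=.
  have [ps pt] := set_mem (valP p).
  rewrite /pullback_tgt -pt (tg_mulx1 gP).
  by rewrite -!surjective_pairing.
- move=> p; apply: val_inj; rewrite pullback_mulE//= (tg_mulxV gP).
  by have [-> pt] := set_mem (valP p).
- move=> p; apply: val_inj; rewrite pullback_mulE//= (tg_mulVx gP).
  by have [ps ->] := set_mem (valP p).
- apply: within_insubd.
    by move=> [p q] /= pq; rewrite -pullback_mulE//; exact/set_mem/valP.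
  apply: within_pair; last first.
    apply: continuous_subspaceT.
    exact: continuous_compose (@continuous_snd _ _) c2.
  apply: within_pair.
    apply: continuous_subspaceT.
    exact: continuous_compose (@continuous_fst _ _) c11.
  apply: (within_compose _ _ (tg_mul_continuous gP)
    (f := fun pq : pullback_arr * pullback_arr =>
      ((val pq.1).1.2, (val pq.2).1.2))).
    by move=> [p q] /= /pullback_composable.
  apply: continuous_pair.
    exact: continuous_compose (@continuous_fst _ _) c12.
  exact: continuous_compose (@continuous_snd _ _) c12.
- apply: continuous_into => /=.
  have cid_ : continuous (fun x : X => x) by move=> ?.
  do 2 apply: continuous_pair => //.
  exact: continuous_compose cf (tg_unit_continuous gP).
- apply: continuous_into => /=.
  do 2 apply: continuous_pair => //.
  exact: continuous_compose c12 (tg_inv_continuous gP).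
Qed.

Definition pullback_groupoid := TopologicalGroupoid pullback_groupoidP.

End pullback_groupoid.

Section strict_morphisms.
Variables K H : topological_groupoid.

Definition is_strict_morphism (f0 : ob K -> ob H) (f1 : arr K -> arr H) : Prop :=
  [/\ forall x, src (f1 x) = f0 (src x),
      forall x, tgt (f1 x) = f0 (tgt x),
      forall a, f1 (unit a) = unit (f0 a) &
      forall x y, tgt x = src y -> f1 (mul x y) = mul (f1 x) (f1 y)].

(* [continuousType] carries the compact-open topology (by the instances of
   [ArrowAsCompactOpen]), [*] the product topology, and a set coerced to a type
   the subspace topology. *)
Definition strict_morphism_set :
    set (continuousType (ob K) (ob H) * continuousType (arr K) (arr H)) :=
  [set f : continuousType (ob K) (ob H) * continuousType (arr K) (arr H)
     | is_strict_morphism f.1 f.2].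

Definition SMor0 : topologicalType := strict_morphism_set.

Definition on_ob (f : SMor0) : continuousType (ob K) (ob H) := (val f).1.
Definition on_arr (f : SMor0) : continuousType (arr K) (arr H) := (val f).2.

Definition is_natural_transformation (f g : SMor0) (a : ob K -> arr H) : Prop :=
  [/\ forall k, src (a k) = on_ob f k,
      forall k, tgt (a k) = on_ob g k &
      forall x, mul (on_arr f x) (a (tgt x)) = mul (a (src x)) (on_arr g x)].

Definition SMor1 : topologicalType :=
  [set p : SMor0 * continuousType (ob K) (arr H)
     | exists g, is_natural_transformation p.1 g p.2].

Definition nat_map (p : SMor1) : continuousType (ob K) (arr H) := (val p).2.

Definition SMor_src (p : SMor1) : SMor0 := (val p).1.
Definition SMor_tgt (p : SMor1) : SMor0 := sval (cid (set_mem (valP p))).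

End strict_morphisms.

Section strict_morphism_operations.

Definition mk_SMor0 (K H : topological_groupoid)
    (f0 : continuousType (ob K) (ob H)) (f1 : continuousType (arr K) (arr H))
    (hf : is_strict_morphism f0 f1) : SMor0 K H :=
  SigSub (mem_set (hf : strict_morphism_set (f0, f1))).

Lemma SMor0P (K H : topological_groupoid) (f : SMor0 K H) :
  is_strict_morphism (on_ob f) (on_arr f).
Proof. exact: set_mem (valP f). Qed.

Lemma precomp_subproof (L K H : topological_groupoid)
    (p : SMor0 L K) (f : SMor0 K H) :
  is_strict_morphism (on_ob f \o on_ob p) (on_arr f \o on_arr p).
Proof.
have [ps pt pu pm] := SMor0P p; have [fs ft fu fm] := SMor0P f.
split=> /= [x|x|a|x y xy]; first by rewrite fs ps.
- by rewrite ft pt.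
- by rewrite pu fu.
- by rewrite pm// fm// pt ps xy.
Qed.

Definition precomp (L K H : topological_groupoid) (p : SMor0 L K)
    (f : SMor0 K H) : SMor0 L H :=
  mk_SMor0 (f0 := on_ob f \o on_ob p) (f1 := on_arr f \o on_arr p)
    (precomp_subproof p f).

Lemma natural_transformation_target_unique (K H : topological_groupoid)
    (f g g' : SMor0 K H) (a : ob K -> arr H) :
  is_natural_transformation f g a -> is_natural_transformation f g' a -> g = g'.
Proof.
move=> [as_ at_ an] [as' at' an'].
have gP := groupoidP H.
have e0 : on_ob g = on_ob g'.
  by apply/continuousEP => k; rewrite -at_ at'.
have e1 : on_arr g = on_arr g'.
  apply/continuousEP => x.
  have [gs _ _ _] := SMor0P g; have [gs' _ _ _] := SMor0P g'.
  have cancel (y : arr H) : tgt (a (src x)) = src y ->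
      mul (inv (a (src x))) (mul (a (src x)) y) = y.
    move=> ay; rewrite (tg_mulA gP)// ?(tg_tgt_inv gP)//.
    by rewrite (tg_mulVx gP) ay (tg_mul1x gP).
  rewrite -(cancel (on_arr g x)); last by rewrite at_ gs.
  rewrite -(cancel (on_arr g' x)); last by rewrite at' gs'.
  by rewrite -an -an'.
apply: val_inj; move: e0 e1; rewrite /on_ob /on_arr.
by case: (val g) (val g') => [? ?] [? ?] /= -> ->.
Qed.

Lemma SMor_tgtP (K H : topological_groupoid) (p : SMor1 K H) (g : SMor0 K H) :
  SMor_tgt p = g <-> is_natural_transformation (SMor_src p) g (nat_map p).
Proof.
have tP : is_natural_transformation (SMor_src p) (SMor_tgt p) (nat_map p).
  exact: (svalP (cid (set_mem (valP p)))).
by split=> [<-//|]; exact: natural_transformation_target_unique.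
Qed.

End strict_morphism_operations.

Section strict_fiber_product.
Variables (K W G : topological_groupoid) (psi : SMor0 K G) (phi : SMor0 W G).

Definition fiber_ob : set (ob K * ob W) :=
  [set p | on_ob psi p.1 = on_ob phi p.2].
Definition fiber_arr : set (arr K * arr W) :=
  [set p | on_arr psi p.1 = on_arr phi p.2].

Lemma fiber_src_subproof (p : fiber_arr) :
  fiber_ob (src (val p).1, src (val p).2).
Proof.
have [ps _ _ _] := SMor0P psi; have [fs _ _ _] := SMor0P phi.
by have := set_mem (valP p); rewrite /fiber_arr /fiber_ob /= -ps -fs => ->.
Qed.

Definition fiber_src (p : fiber_arr) : fiber_ob :=
  SigSub (mem_set (fiber_src_subproof p)).

Lemma fiber_tgt_subproof (p : fiber_arr) :
  fiber_ob (tgt (val p).1, tgt (val p).2).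
Proof.
have [_ pt _ _] := SMor0P psi; have [_ ft _ _] := SMor0P phi.
by have := set_mem (valP p); rewrite /fiber_arr /fiber_ob /= -pt -ft => ->.
Qed.

Definition fiber_tgt (p : fiber_arr) : fiber_ob :=
  SigSub (mem_set (fiber_tgt_subproof p)).

(* The value off the composable pairs is the irrelevant default [p]. *)
Definition fiber_mul (p q : fiber_arr) : fiber_arr :=
  set_insubd p (mul (val p).1 (val q).1, mul (val p).2 (val q).2).

Lemma fiber_unit_subproof (a : fiber_ob) :
  fiber_arr (unit (val a).1, unit (val a).2).
Proof.
have [_ _ pu _] := SMor0P psi; have [_ _ fu _] := SMor0P phi.
by rewrite /fiber_arr /= pu fu; congr unit; exact: set_mem (valP a).
Qed.

Definition fiber_unit (a : fiber_ob) : fiber_arr :=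
  SigSub (mem_set (fiber_unit_subproof a)).

Lemma strict_morphism_inv (L M : topological_groupoid) (f : SMor0 L M)
    (x : arr L) : on_arr f (inv x) = inv (on_arr f x).
Proof.
have [fs ft fu fm] := SMor0P f; have lP := groupoidP L; have mP := groupoidP M.
have e : mul (on_arr f x) (on_arr f (inv x)) = unit (on_ob f (src x)).
  by rewrite -fm ?(tg_src_inv lP)// (tg_mulxV lP) fu.
have sfi : src (on_arr f (inv x)) = tgt (on_arr f x).
  by rewrite fs ft (tg_src_inv lP).
rewrite -[LHS](tg_mul1x mP) sfi -(tg_mulVx mP) -(tg_mulA mP) ?sfi//; last first.
  exact: tg_tgt_inv mP _.
by rewrite e -fs -(tg_tgt_inv mP) (tg_mulx1 mP).
Qed.

Lemma fiber_inv_subproof (p : fiber_arr) :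
  fiber_arr (inv (val p).1, inv (val p).2).
Proof.
rewrite /fiber_arr /= !strict_morphism_inv; congr inv.
exact: set_mem (valP p).
Qed.

Definition fiber_inv (p : fiber_arr) : fiber_arr :=
  SigSub (mem_set (fiber_inv_subproof p)).

Lemma fiber_composable (p q : fiber_arr) : fiber_tgt p = fiber_src q ->
  tgt (val p).1 = src (val q).1 /\ tgt (val p).2 = src (val q).2.
Proof. by move=> /(congr1 val) []. Qed.

Lemma fiber_mulE (p q : fiber_arr) : fiber_tgt p = fiber_src q ->
  val (fiber_mul p q) = (mul (val p).1 (val q).1, mul (val p).2 (val q).2).
Proof.
move=> /fiber_composable[pq1 pq2]; rewrite /fiber_mul set_insubdK//.
have [_ _ _ pm] := SMor0P psi; have [_ _ _ fm] := SMor0P phi.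
have ep := set_mem (valP p); have eq_ := set_mem (valP q).
rewrite /fiber_arr /= in ep eq_ *.
by rewrite pm// fm// ep eq_.
Qed.

Lemma fiber_groupoidP : is_topological_groupoid
  fiber_src fiber_tgt fiber_mul fiber_unit fiber_inv.
Proof.
have kP := groupoidP K; have wP := groupoidP W.
have ca1 : continuous (fun p : fiber_arr => (val p).1).
  exact: continuous_compose (@continuous_val _ _) (@continuous_fst _ _).
have ca2 : continuous (fun p : fiber_arr => (val p).2).
  exact: continuous_compose (@continuous_val _ _) (@continuous_snd _ _).
have co1 : continuous (fun p : fiber_ob => (val p).1).
  exact: continuous_compose (@continuous_val _ _) (@continuous_fst _ _).
have co2 : continuous (fun p : fiber_ob => (val p).2).
  exact: continuous_compose (@continuous_val _ _) (@continuous_snd _ _).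
have sm (p q : fiber_arr) : fiber_tgt p = fiber_src q ->
    fiber_src (fiber_mul p q) = fiber_src p.
  move=> pq; have [pq1 pq2] := fiber_composable pq.
  by apply: val_inj; rewrite /= fiber_mulE//= (tg_src_mul kP)// (tg_src_mul wP).
have tm (p q : fiber_arr) : fiber_tgt p = fiber_src q ->
    fiber_tgt (fiber_mul p q) = fiber_tgt q.
  move=> pq; have [pq1 pq2] := fiber_composable pq.
  by apply: val_inj; rewrite /= fiber_mulE//= (tg_tgt_mul kP)// (tg_tgt_mul wP).
have su (a : fiber_ob) : fiber_src (fiber_unit a) = a.
  apply: val_inj; rewrite /= (tg_src_unit kP) (tg_src_unit wP).
  by rewrite -surjective_pairing.
have tu (a : fiber_ob) : fiber_tgt (fiber_unit a) = a.
  apply: val_inj; rewrite /= (tg_tgt_unit kP) (tg_tgt_unit wP).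
  by rewrite -surjective_pairing.
have si (p : fiber_arr) : fiber_src (fiber_inv p) = fiber_tgt p.
  by apply: val_inj; rewrite /= (tg_src_inv kP) (tg_src_inv wP).
have ti (p : fiber_arr) : fiber_tgt (fiber_inv p) = fiber_src p.
  by apply: val_inj; rewrite /= (tg_tgt_inv kP) (tg_tgt_inv wP).
split => //.
- move=> p q r pq qr.
  have [pq1 pq2] := fiber_composable pq; have [qr1 qr2] := fiber_composable qr.
  apply: val_inj; rewrite !fiber_mulE ?sm ?tm//=.
  by rewrite (tg_mulA kP)// (tg_mulA wP).
- move=> p; apply: val_inj; rewrite fiber_mulE ?tu//=.
  by rewrite (tg_mul1x kP) (tg_mul1x wP) -surjective_pairing.
- move=> p; apply: val_inj; rewrite fiber_mulE ?su//=.
  by rewrite (tg_mulx1 kP) (tg_mulx1 wP) -surjective_pairing.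
- move=> p; apply: val_inj; rewrite fiber_mulE ?si//=.
  by rewrite (tg_mulxV kP) (tg_mulxV wP).
- move=> p; apply: val_inj; rewrite fiber_mulE ?ti//=.
  by rewrite (tg_mulVx kP) (tg_mulVx wP).
- apply: continuous_into => /=; apply: continuous_pair.
    exact: continuous_compose ca1 (tg_src_continuous kP).
  exact: continuous_compose ca2 (tg_src_continuous wP).
- apply: continuous_into => /=; apply: continuous_pair.
    exact: continuous_compose ca1 (tg_tgt_continuous kP).
  exact: continuous_compose ca2 (tg_tgt_continuous wP).
- apply: within_insubd.
    by move=> [p q] /= pq; rewrite -fiber_mulE//; exact/set_mem/valP.
  apply: within_pair.
    apply: (within_compose _ _ (tg_mul_continuous kP)
      (f := fun pq : fiber_arr * fiber_arr => ((val pq.1).1, (val pq.2).1))).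
      by move=> [p q] /= /fiber_composable[].
    apply: continuous_pair.
      exact: continuous_compose (@continuous_fst _ _) ca1.
    exact: continuous_compose (@continuous_snd _ _) ca1.
  apply: (within_compose _ _ (tg_mul_continuous wP)
    (f := fun pq : fiber_arr * fiber_arr => ((val pq.1).2, (val pq.2).2))).
    by move=> [p q] /= /fiber_composable[].
  apply: continuous_pair.
    exact: continuous_compose (@continuous_fst _ _) ca2.
  exact: continuous_compose (@continuous_snd _ _) ca2.
- apply: continuous_into => /=; apply: continuous_pair.
    exact: continuous_compose co1 (tg_unit_continuous kP).
  exact: continuous_compose co2 (tg_unit_continuous wP).
- apply: continuous_into => /=; apply: continuous_pair.
    exact: continuous_compose ca1 (tg_inv_continuous kP).
  exact: continuous_compose ca2 (tg_inv_continuous wP).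
Qed.

Definition fiber_product := TopologicalGroupoid fiber_groupoidP.

Lemma fiber_proj1_ob_continuous : continuous (fun p : fiber_ob => (val p).1).
Proof. exact: continuous_compose (@continuous_val _ _) (@continuous_fst _ _). Qed.
Lemma fiber_proj1_arr_continuous : continuous (fun p : fiber_arr => (val p).1).
Proof. exact: continuous_compose (@continuous_val _ _) (@continuous_fst _ _). Qed.
Lemma fiber_proj2_ob_continuous : continuous (fun p : fiber_ob => (val p).2).
Proof. exact: continuous_compose (@continuous_val _ _) (@continuous_snd _ _). Qed.
Lemma fiber_proj2_arr_continuous : continuous (fun p : fiber_arr => (val p).2).
Proof. exact: continuous_compose (@continuous_val _ _) (@continuous_snd _ _). Qed.

Lemma fiber_proj1_subproof : @is_strict_morphism fiber_product K
  (mkcts fiber_proj1_ob_continuous) (mkcts fiber_proj1_arr_continuous).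
Proof. by split => // p q pq; rewrite /mkcts /= fiber_mulE. Qed.

Lemma fiber_proj2_subproof : @is_strict_morphism fiber_product W
  (mkcts fiber_proj2_ob_continuous) (mkcts fiber_proj2_arr_continuous).
Proof. by split => // p q pq; rewrite /mkcts /= fiber_mulE. Qed.

Definition fiber_proj1 : SMor0 fiber_product K := mk_SMor0 fiber_proj1_subproof.
Definition fiber_proj2 : SMor0 fiber_product W := mk_SMor0 fiber_proj2_subproof.

Definition fiber_pair (k : ob K) (w : ob W) (h : on_ob psi k = on_ob phi w) :
    ob fiber_product :=
  SigSub (mem_set (h : fiber_ob (k, w))).

End strict_fiber_product.

Section open_refinements.
Variable G : topological_groupoid.

Definition full (K : topological_groupoid) (psi : SMor0 K G) : Prop :=
  forall (a b : ob K) (x : arr G), src x = on_ob psi a -> tgt x = on_ob psi b ->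
    exists y : arr K, [/\ src y = a, tgt y = b & on_arr psi y = x].

Definition faithful (K : topological_groupoid) (psi : SMor0 K G) : Prop :=
  forall y y' : arr K, src y = src y' -> tgt y = tgt y' ->
    on_arr psi y = on_arr psi y' -> y = y'.

Definition full_equivalence (K : topological_groupoid) (psi : SMor0 K G) : Prop :=
  [/\ full psi, faithful psi & forall c : ob G, exists a : ob K, on_ob psi a = c].

(* Repetitions and empty members are allowed. *)
Record open_family := OpenFamily {
  family_index : Type ;
  family_set : family_index -> set (ob G) ;
  family_open : forall i, open (family_set i)
}.

Definition disjoint_union (U : open_family) : topologicalType :=
  {i : {classic family_index U} & family_set i}.

Definition natural_map (U : open_family) (a : disjoint_union U) : ob G :=
  val (projT2 a).

Lemma natural_map_continuous (U : open_family) : continuous (@natural_map U).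
Proof.
by move=> [i a]; exact: (@continuous_val _ (family_set i) a).
Qed.

Definition refinement_groupoid (U : open_family) : topological_groupoid :=
  pullback_groupoid (@natural_map_continuous U).

Lemma refinement_map_arr_continuous (U : open_family) :
  continuous (fun p : arr (refinement_groupoid U) => (val p).1.2).
Proof.
apply: continuous_compose (@continuous_snd _ _).
apply: continuous_compose (@continuous_fst _ _).
exact: continuous_val.
Qed.

Lemma refinement_map_subproof (U : open_family) :
  @is_strict_morphism (refinement_groupoid U) G
    (mkcts (@natural_map_continuous U)) (mkcts (@refinement_map_arr_continuous U)).
Proof.
split => //.
- by move=> p; have [] := set_mem (valP p).
- by move=> p; have [] := set_mem (valP p).
- by move=> p q pq; rewrite /mkcts /= pullback_mulE.
Qed.

Definition refinement_map (U : open_family) : SMor0 (refinement_groupoid U) G :=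
  mk_SMor0 (refinement_map_subproof U).

Record open_refinement := OpenRefinement {
  refinement_family : open_family ;
  refinementP : full_equivalence (refinement_map refinement_family)
}.

HB.instance Definition _ := gen_eqMixin open_refinement.
HB.instance Definition _ := gen_choiceMixin open_refinement.

End open_refinements.

Definition refinement_dom (G : topological_groupoid) (psi : open_refinement G) :
    topological_groupoid :=
  refinement_groupoid (refinement_family psi).

Definition refinement_mor (G : topological_groupoid) (psi : open_refinement G) :
    SMor0 (refinement_dom psi) G :=
  refinement_map (refinement_family psi).

Section OFMor.
Variables G H : topological_groupoid.

Definition OFMor0 : topologicalType :=
  {psi : open_refinement G & SMor0 (refinement_dom psi) H}.

Definition refinement_product (psi phi : open_refinement G) :
    topological_groupoid :=
  fiber_product (refinement_mor psi) (refinement_mor phi).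

Definition OFMor1_component (psi phi : open_refinement G) : topologicalType :=
  [set p : SMor0 (refinement_dom psi) H * SMor1 (refinement_product psi phi) H
           * SMor0 (refinement_dom phi) H
     | precomp (fiber_proj1 _ _) p.1.1 = SMor_src p.1.2 /\
       SMor_tgt p.1.2 = precomp (fiber_proj2 _ _) p.2].

Definition component_src psi phi (p : OFMor1_component psi phi) :
  SMor0 (refinement_dom psi) H := (val p).1.1.

Definition component_tgt psi phi (p : OFMor1_component psi phi) :
  SMor0 (refinement_dom phi) H := (val p).2.

(* The arrow [p(k, w)] of [H]. *)
Definition component_eval psi phi (p : OFMor1_component psi phi)
    (k : ob (refinement_dom psi)) (w : ob (refinement_dom phi))
    (h : on_ob (refinement_mor psi) k = on_ob (refinement_mor phi) w) : arr H :=
  nat_map (val p).1.2 (fiber_pair h).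

Definition OFMor1 : topologicalType :=
  {pq : open_refinement G * open_refinement G & OFMor1_component pq.1 pq.2}.

Definition OFMor_arr psi phi (p : OFMor1_component psi phi) : OFMor1 :=
  existT (fun pq => OFMor1_component pq.1 pq.2) (psi, phi) p.

Definition OFMor_src (p : OFMor1) : OFMor0 :=
  existT (fun psi => SMor0 (refinement_dom psi) H) (projT1 p).1
    (component_src (projT2 p)).

Definition OFMor_tgt (p : OFMor1) : OFMor0 :=
  existT (fun psi => SMor0 (refinement_dom psi) H) (projT1 p).2
    (component_tgt (projT2 p)).

(* This determines [m] on composable pairs: [psi] being surjective on objects,
   a suitable [w] exists for every [(k, v)]. *)
Definition is_OFMor_composition (m : OFMor1 -> OFMor1 -> OFMor1) : Prop :=
  forall (psi phi chi : open_refinement G)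
    (p : OFMor1_component psi phi) (q : OFMor1_component phi chi),
    component_tgt p = component_src q ->
    exists2 r : OFMor1_component psi chi,
      m (OFMor_arr p) (OFMor_arr q) = OFMor_arr r &
      forall k v w hkv hkw hwv,
        @component_eval _ _ r k v hkv =
        mul (@component_eval _ _ p k w hkw) (@component_eval _ _ q w v hwv).

End OFMor.

(* Main.v *)
Require Import Defs.
From mathcomp Require Import all_boot all_classical topology.
(* Makes [mul] the multiplication of a groupoid rather than that of a magma. *)
Import Defs.

(** An arrow [p] from [(psi, K, u)] to [(phi, W, w)] is a continuous family of
arrows [p(k, w) : u(k) -> w(w)] of [H] indexed by the pairs with the same image
in [G^0].  Algebraically everything follows from naturality along the arrows of
[K x_G W] that lie over units of [G] ([connecting_arr]): it makes
[p(k, w) q(w, v)] independent of the intermediate object [w]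
([component_mul_via_indep]), and it shows that [u^1(k, 1, k')] is a unit and
[p(k, w)^-1] an inverse.

Continuity of composition is where openness and regularity enter.  The object
map of an open refinement is a surjection with continuous local sections, so that
locally on [K x_G V] the object [w] is a continuous function of [(k, v)]
([local_via]).  This makes [p(k, w) q(w, v)] continuous in [(k, v)].  For the
continuity in [(p, q)], take a compact set [C] of pairs [(k, v)]: the section need
not extend over [C], so [C] has to be cut into finitely many compact pieces, each
lying where a section is defined.  Pieces that are compact are obtained by
intersecting [C] with closed neighbourhoods, and these are arbitrarily small
because [K^0], [V^0] and [K x_G V], being built from open subspaces of [G^0] by
sums, products and subspaces, inherit regularity.  The resulting principle is
[regular_compact_open_continuous]: over a regular space, continuity into a
compact-open function space can be tested on small compact sets.

Units and inverses are continuous since they are given by composing with fixed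
continuous maps, and the disjoint union topologies reduce every claim on
[OFMor] to one on the spaces [OFMor1_component psi phi]. *)

Set Implicit Arguments.
Unset Strict Implicit.
Unset Printing Implicit Defensive.

Local Open Scope classical_set_scope.

Import ArrowAsCompactOpen.

(** * Regular spaces *)

Section regular_spaces.

Lemma regular_set_type (X : topologicalType) (S : set X) :
  regular_space X -> regular_space S.
Proof.
move=> rX x A [_ [[O oO <-] /= Ox OA]].
have [B Bx BO] := rX (val x) O (open_nbhs_nbhs (conj oO Ox)).
exists (set_val @^-1` B); first exact: (@continuous_val _ S x).
move=> y clB; apply/OA/BO => C Cy.
have [z [Bz Cz]] := clB _ (@continuous_val _ S y _ Cy).
by exists (val z).
Qed.

Lemma regular_prod (X Y : topologicalType) :
  regular_space X -> regular_space Y -> regular_space (X * Y)%type.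
Proof.
move=> rX rY [x y] A [[P Q] /= [Px Qy] PQA].
have [B Bx BP] := rX _ _ Px; have [C Cy CQ] := rY _ _ Qy.
exists (B `*` C); first by exists (B, C).
move=> [x' y'] clBC; apply: PQA; split => /=.
  apply: BP => D Dx'; have [|[z1 z2] [[/= Bz _] Dz]] := clBC (D `*` setT).
    by exists (D, setT) => //; split => //; exact: filterT.
  by exists z1; split => //; case: Dz.
apply: CQ => D Dy'; have [|[z1 z2] [[/= _ Cz] Dz]] := clBC (setT `*` D).
  by exists (setT, D) => //; split => //; exact: filterT.
by exists z2; split => //; case: Dz.
Qed.

Lemma regular_sigT (I : choiceType) (X : I -> topologicalType) :
  (forall i, regular_space (X i)) -> regular_space {i & X i}.
Proof.
move=> rX [i x] A Ax; have [B Bx BA] := rX i x _ Ax.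
exists (existT X i @` B); first exact: existT_nbhs.
move=> [j y] clB.
have [|_ [[z Bz <-] [w _ e]]] := clB (existT X j @` setT).
  by apply: existT_nbhs; exact: filterT.
have ji := existT_inj1 e; subst j.
apply: BA => D Dy.
have [|_ [[t Bt <-] [t' Dt' e']]] := clB (existT X i @` D).
  exact: existT_nbhs.
by exists t; split => //; rewrite -(existT_inj2 e').
Qed.

End regular_spaces.

(** * Continuity on subsets *)

Section continuity_within.

(** Unlike [within_compose], the inner map need only be continuous on [A]; this is
what composing with a local section requires. *)
Lemma within_comp_within (X Y Z : topologicalType) (A : set X) (B : set Y)
    (f : X -> Y) (g : Y -> Z) :
  (forall x, A x -> B (f x)) -> {within A, continuous f} ->
  {within B, continuous g} -> {within A, continuous (fun x => g (f x))}.
Proof.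
move=> AB /subspace_continuousP cf /subspace_continuousP cg.
apply/subspace_continuousP => x Ax U gU.
have V : nbhs (f x) [set z | B z -> U (g z)] := cg _ (AB _ Ax) _ gU.
have W : nbhs x [set y | A y -> B (f y) -> U (g (f y))] := cf _ Ax _ V.
by apply: filterS W => y Wy Ay; exact: Wy Ay (AB _ Ay).
Qed.

Lemma continuous_at_locally (X Y : topologicalType) (f g : X -> Y) (N : set X)
    (x : X) : nbhs x N -> {within N, continuous g} ->
  (forall y, N y -> f y = g y) -> {for x, continuous f}.
Proof.
move=> Nx /subspace_continuousP /(_ x (nbhs_singleton Nx)) cg fg U.
rewrite (fg _ (nbhs_singleton Nx)) => gU.
have V : nbhs x [set y | N y -> U (g y)] := cg _ gU.
by apply: filterS2 V Nx => y V Ny; rewrite /= fg//; exact: V.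
Qed.

End continuity_within.

(** * The compact-open topology *)

Section compact_open_topology.

Lemma near_compact_open (X Y : topologicalType) (f : continuousType X Y)
    (C : set X) (O : set Y) : compact C -> open O -> f @` C `<=` O ->
  \forall g \near f, (g : continuousType X Y) @` C `<=` O.
Proof.
move=> cC oO fCO.
have := @initial_continuous _ _ (id : continuousType X Y -> (X -> Y)) f.
move=> /(_ [set g | g @` C `<=` O]); apply.
by apply: open_nbhs_nbhs; split => //; exact: compact_open_open.
Qed.

Lemma compact_open_continuous (I X Y : topologicalType)
    (F : I -> continuousType X Y) :
  (forall i C O, compact C -> open O -> F i @` C `<=` O ->
     \forall j \near i, F j @` C `<=` O) -> continuous F.
Proof.
move=> HF; apply: continuous_comp_initial => i.
apply/compact_open_cvgP => C O cC oO FCO; exact: HF.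
Qed.

Lemma precompose_continuous (X Y Z : topologicalType) (f : continuousType X Y) :
  continuous (fun g : continuousType Y Z => g \o f : continuousType X Z).
Proof.
apply: compact_open_continuous => g C O cC oO gfO.
have cfC : compact (f @` C).
  by apply: continuous_compact => //; exact/continuous_subspaceT/cts_fun.
have gfCO : g @` (f @` C) `<=` O by rewrite image_comp.
apply: filterS (near_compact_open cfC oO gfCO) => h /=.
by rewrite image_comp.
Qed.

Lemma postcompose_continuous (X Y Z : topologicalType) (f : continuousType Y Z) :
  continuous (fun g : continuousType X Y => f \o g : continuousType X Z).
Proof.
apply: compact_open_continuous => g C O cC oO gfO.
have oP : open (f @^-1` O) by apply: open_comp => // ? _; exact: cts_fun.
have : g @` C `<=` f @^-1` O by move=> _ [x Cx <-]; apply: gfO; exists x.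
move=> /(near_compact_open cC oP); apply: filterS => h hC _ [x Cx <-].
by apply: hC; exists x.
Qed.

(** Every point of a compact set [C] has a closed neighbourhood [closure B] inside
the given [N], and [C `&` closure B] is compact.  Compactness of [C] then leaves finitely many such pieces. *)
Lemma regular_compact_open_continuous (I X Y : topologicalType)
    (F : I -> continuousType X Y) : regular_space X ->
  (forall i x O, open O -> O (F i x) -> exists2 N, nbhs x N &
     forall C, compact C -> C `<=` N -> \forall j \near i, F j @` C `<=` O) ->
  continuous F.
Proof.
move=> rX HF; apply: compact_open_continuous => i C O cC oO FCO.
have : near_covering_within C.
  exact/near_covering_withinP/compact_near_coveringP.
move=> /(_ _ (nbhs i) (fun j x => O (F j x))) cov.
suff : \near i, C `<=` (fun x => O (F i x)).
  by apply: filterS => j CO _ [x Cx <-]; exact: CO.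
apply: cov => x Cx; have [|N Nx HN] := HF i x O oO.
  by apply: FCO; exists x.
have [B Bx BN] := rX x N Nx.
have := HN (C `&` closure B) (compact_closedI cC (@closed_closure _ B)).
move=> /(_ (subset_trans (@subIsetr _ _ _) BN)) Hj.
exists (B, [set j | F j @` (C `&` closure B) `<=` O]) => // -[y j] /= [By +] Cy.
by apply; exists y => //; split => //; exact: subset_closure.
Qed.

End compact_open_topology.

(** * Local sections of open refinements *)

Section open_refinement_theory.
Variable G : topological_groupoid.
Implicit Types psi phi chi : open_refinement G.

Local Notation fob psi phi := (fiber_ob (refinement_mor psi) (refinement_mor phi)).

Lemma regular_refinement_dom psi :
  regular_space (ob G) -> regular_space (ob (refinement_dom psi)).
Proof. by move=> rG; apply: regular_sigT => i; exact: regular_set_type. Qed.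

Lemma regular_refinement_product psi phi :
  regular_space (ob G) -> regular_space (ob (refinement_product psi phi)).
Proof.
move=> rG; apply: regular_set_type.
by apply: regular_prod; exact: regular_refinement_dom.
Qed.

(** The component [U_i] of [K^0] is an open subset of [G^0], so its inclusion has
an inverse defined on a neighbourhood. *)
Lemma refinement_section psi (k : ob (refinement_dom psi)) :
  exists (U : set (ob G)) (s : ob G -> ob (refinement_dom psi)),
    [/\ nbhs (on_ob (refinement_mor psi) k) U, {within U, continuous s} &
        forall c, U c -> on_ob (refinement_mor psi) (s c) = c].
Proof.
case: k => i x; pose U := family_set i.
exists U, (fun c => existT _ i (set_insubd x c)); split.
- apply: open_nbhs_nbhs; split; first exact: family_open.
  exact: set_mem (valP x).
- have cid_ : {within U, continuous (fun c : ob G => c)}.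
    by apply: continuous_subspaceT => ?.
  have cs := within_insubd (d := fun=> x) (fun c (Uc : U c) => Uc) cid_.
  by move=> c; apply: (@continuous_comp _ _ _ _ (existT _ i)); [exact: cs|].
- by move=> c Uc; exact: set_insubdK.
Qed.

(** For [y = (k, v)]: the pairs [a] and [b] are [(k, w)] and [(w, v)] for a common
[w]. *)
Definition via psi phi chi (y : fob psi chi) (a : fob psi phi) (b : fob phi chi) :=
  [/\ (val a).1 = (val y).1, (val a).2 = (val b).1 & (val b).2 = (val y).2].

Lemma exists_via psi phi chi (y : fob psi chi) :
  exists ab : fob psi phi * fob phi chi, via y ab.1 ab.2.
Proof.
have [_ _ /(_ (on_ob (refinement_mor psi) (val y).1))[w ew]] := refinementP phi.
have ey : on_ob (refinement_mor psi) (val y).1 =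
  on_ob (refinement_mor chi) (val y).2 := set_mem (valP y).
by exists (fiber_pair (esym ew), fiber_pair (etrans ew ey)).
Qed.

(** The intermediate object is a continuous function of [y] locally, by a section
of [phi] applied to the common image of [y] in [G^0]. *)
Lemma local_via psi phi chi (y : fob psi chi) :
  exists (N : set (fob psi chi)) (s : fob psi chi -> fob psi phi)
         (t : fob psi chi -> fob phi chi),
  [/\ nbhs y N, {within N, continuous s}, {within N, continuous t} &
      forall z, N z -> via z (s z) (t z)].
Proof.
have [[a b] /= [ay ab by_]] := exists_via phi y.
have [U [r [Uy cr rK]]] := refinement_section (val a).2.
pose f (z : fob psi chi) := on_ob (refinement_mor psi) (val z).1.
have c1 : continuous (fun z : fob psi chi => (val z).1).
  exact: fiber_proj1_ob_continuous.
have c2 : continuous (fun z : fob psi chi => (val z).2).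
  exact: fiber_proj2_ob_continuous.
have cf : continuous f by exact: continuous_compose c1 (@cts_fun _ _ _).
have fE z : f z = on_ob (refinement_mor chi) (val z).2 := set_mem (valP z).
have ea : on_ob (refinement_mor psi) (val a).1 =
  on_ob (refinement_mor phi) (val a).2 := set_mem (valP a).
pose N := f @^-1` U.
have crf : {within N, continuous (fun z => r (f z))}.
  exact: (within_compose (B := U)).
exists N, (fun z => set_insubd a ((val z).1, r (f z))),
  (fun z => set_insubd b (r (f z), (val z).2)); split.
- by apply: cf; rewrite /f -ay ea.
- apply: (within_insubd (d := fun=> a)).
    by move=> z Nz; rewrite /fiber_ob /= rK.
  by apply: within_pair => //; exact: continuous_subspaceT.
- apply: (within_insubd (d := fun=> b)).
    by move=> z Nz; rewrite /fiber_ob /= rK// fE.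
  by apply: within_pair => //; exact: continuous_subspaceT.
- move=> z Nz; rewrite /via !set_insubdK//= /fiber_ob /= rK// fE//.
Qed.

Lemma connecting_arr_subproof psi (y : fob psi psi) :
  pullback_arr (@natural_map G (refinement_family psi))
    ((val y).1, unit (on_ob (refinement_mor psi) (val y).1), (val y).2).
Proof.
split => /=; first by rewrite (tg_src_unit (groupoidP G)).
by rewrite (tg_tgt_unit (groupoidP G)); exact: set_mem (valP y).
Qed.

(** The arrow [k -> k'] over the unit of the common image of [k] and [k']. *)
Definition connecting_arr psi (y : ob (refinement_product psi psi)) :
  arr (refinement_dom psi) := SigSub (mem_set (connecting_arr_subproof y)).

Lemma connecting_arr_continuous psi : continuous (@connecting_arr psi).
Proof.
have c1 := @fiber_proj1_ob_continuous _ _ _ (refinement_mor psi) (refinement_mor psi).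
have c2 := @fiber_proj2_ob_continuous _ _ _ (refinement_mor psi) (refinement_mor psi).
apply: continuous_into => /=.
do 2 apply: continuous_pair => //.
apply: continuous_compose (tg_unit_continuous (groupoidP G)).
exact: continuous_compose c1 (@cts_fun _ _ _).
Qed.

Lemma connecting_arr_over psi (y : fob psi psi) :
  on_arr (refinement_mor psi) (connecting_arr y) =
  unit (on_ob (refinement_mor psi) (val y).1).
Proof. by []. Qed.

Lemma src_connecting_arr psi (y : fob psi psi) : src (connecting_arr y) = (val y).1.
Proof. by []. Qed.

Lemma tgt_connecting_arr psi (y : fob psi psi) : tgt (connecting_arr y) = (val y).2.
Proof. by []. Qed.

End open_refinement_theory.

(** * Arrows between two components *)

Section components.
Variables G H : topological_groupoid.
Implicit Types psi phi chi : open_refinement G.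

Local Notation fob psi phi := (fiber_ob (refinement_mor psi) (refinement_mor phi)).
Local Notation comp psi phi := (OFMor1_component H psi phi).

Definition component_map psi phi (p : comp psi phi) :
    continuousType (ob (refinement_product psi phi)) (arr H) :=
  nat_map (val p).1.2.

(** Naturality of [u \o pi_1 => w \o pi_2], with the arrows of the fiber product
and their end points given by their coordinates. *)
Definition component_natural psi phi (u : SMor0 (refinement_dom psi) H)
    (w : SMor0 (refinement_dom phi) H) (f : fob psi phi -> arr H) :=
  [/\ forall a, src (f a) = on_ob u (val a).1,
      forall a, tgt (f a) = on_ob w (val a).2 &
      forall a b x z, src x = (val a).1 -> tgt x = (val b).1 ->
        src z = (val a).2 -> tgt z = (val b).2 ->
        on_arr (refinement_mor psi) x = on_arr (refinement_mor phi) z ->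
        mul (on_arr u x) (f b) = mul (f a) (on_arr w z)].

Lemma component_naturalP psi phi (u : SMor0 (refinement_dom psi) H)
    (w : SMor0 (refinement_dom phi) H) (f : fob psi phi -> arr H) :
  component_natural u w f <->
  @is_natural_transformation (refinement_product psi phi) H
    (precomp (fiber_proj1 _ _) u) (precomp (fiber_proj2 _ _) w) f.
Proof.
split=> -[fs ft fn]; split => //.
  move=> x; change (mul (on_arr u (val x).1) (f (fiber_tgt x)) =
    mul (f (fiber_src x)) (on_arr w (val x).2)).
  by apply: fn; [reflexivity..|exact: set_mem (valP x)].
move=> a b x z xa xb za zb xz.
pose q : fiber_arr _ _ := SigSub (mem_set (xz : fiber_arr _ _ (x, z))).
have <- : fiber_tgt q = b by apply: val_inj; rewrite [RHS]surjective_pairing -xb -zb.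
have <- : fiber_src q = a by apply: val_inj; rewrite [RHS]surjective_pairing -xa -za.
exact: (fn q).
Qed.

Lemma componentP psi phi (p : comp psi phi) :
  component_natural (component_src p) (component_tgt p) (component_map p).
Proof.
have [e1 e2] := set_mem (valP p).
by apply/component_naturalP; rewrite e1; apply/SMor_tgtP.
Qed.

Section make.
Variables (psi phi : open_refinement G) (u : SMor0 (refinement_dom psi) H).
Variables (w : SMor0 (refinement_dom phi) H).
Variable f : continuousType (ob (refinement_product psi phi)) (arr H).
Hypothesis fP : component_natural u w f.

Lemma component_nat_subproof : exists g, is_natural_transformation
  (precomp (fiber_proj1 (refinement_mor psi) (refinement_mor phi)) u) g f.
Proof. by exists (precomp (fiber_proj2 _ _) w); exact/component_naturalP. Qed.

Definition component_nat : SMor1 (refinement_product psi phi) H :=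
  exist _
    (precomp (fiber_proj1 (refinement_mor psi) (refinement_mor phi)) u, f)
    (mem_set component_nat_subproof).

Lemma mk_component_subproof :
  precomp (fiber_proj1 (refinement_mor psi) (refinement_mor phi)) u =
    SMor_src component_nat /\ SMor_tgt component_nat =
    precomp (fiber_proj2 (refinement_mor psi) (refinement_mor phi)) w.
Proof. by split => //; apply/SMor_tgtP/component_naturalP. Qed.

Definition mk_component : comp psi phi :=
  exist _ (u, component_nat, w) (mem_set mk_component_subproof).

Lemma src_mk_component : component_src mk_component = u. Proof. by []. Qed.

Lemma tgt_mk_component : component_tgt mk_component = w. Proof. by []. Qed.

Lemma map_mk_component : component_map mk_component = f. Proof. by []. Qed.

End make.

Lemma SMor1_ext (K M : topological_groupoid) (a b : SMor1 K M) :
  SMor_src a = SMor_src b -> nat_map a =1 nat_map b -> a = b.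
Proof.
move=> e /continuousEP em; apply: val_inj.
exact: injective_projections.
Qed.

(** The source strict morphism recorded in the natural transformation is
determined by that of the component. *)
Lemma component_ext psi phi (p q : comp psi phi) :
  component_src p = component_src q -> component_tgt p = component_tgt q ->
  component_map p =1 component_map q -> p = q.
Proof.
move=> es et em; apply: val_inj.
have [p1 _] := set_mem (valP p); have [q1 _] := set_mem (valP q).
apply: injective_projections; last exact: et.
apply: injective_projections; first exact: es.
apply: SMor1_ext; last exact: em.
by rewrite -p1 -q1; congr (precomp _ _); exact: es.
Qed.

Lemma precomp_continuous (L K M : topological_groupoid) (p : SMor0 L K) :
  continuous (fun f : SMor0 K M => precomp p f).
Proof.
apply: continuous_into => /=.
have cv := @continuous_val _ (@strict_morphism_set K M).
apply: continuous_pair.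
  apply: continuous_compose (@precompose_continuous _ _ _ (on_ob p)).
  exact: continuous_compose cv (@continuous_fst _ _).
apply: continuous_compose (@precompose_continuous _ _ _ (on_arr p)).
exact: continuous_compose cv (@continuous_snd _ _).
Qed.

Lemma component_src_continuous psi phi :
  continuous (@component_src G H psi phi).
Proof.
apply: continuous_compose (@continuous_fst _ _).
exact: continuous_compose (@continuous_val _ _) (@continuous_fst _ _).
Qed.

Lemma component_tgt_continuous psi phi :
  continuous (@component_tgt G H psi phi).
Proof. exact: continuous_compose (@continuous_val _ _) (@continuous_snd _ _). Qed.

Lemma component_map_continuous psi phi :
  continuous (@component_map psi phi).
Proof.
apply: continuous_compose (@continuous_snd _ _).
apply: continuous_compose (@continuous_val _ _).
apply: continuous_compose (@continuous_snd _ _).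
exact: continuous_compose (@continuous_val _ _) (@continuous_fst _ _).
Qed.

Lemma continuous_into_component (X : topologicalType) psi phi
    (F : X -> comp psi phi) S T M :
  (forall x, component_src (F x) = S x) -> (forall x, component_tgt (F x) = T x) ->
  (forall x, component_map (F x) = M x) ->
  continuous S -> continuous T -> continuous M -> continuous F.
Proof.
move=> /funext <- /funext <- /funext <- cs ct cm; apply: continuous_into.
have -> : (fun x => val (F x)) =
    (fun x => (component_src (F x), (val (F x)).1.2, component_tgt (F x))).
  by apply/funext => x; rewrite /component_src /component_tgt -!surjective_pairing.
apply: (continuous_pair _ ct); apply: (continuous_pair cs).
apply: continuous_into.
have -> : (fun x => val (val (F x)).1.2) = (fun x =>
    (precomp (fiber_proj1 _ _) (component_src (F x)), component_map (F x))).
  apply/funext => x; have [e _] := set_mem (valP (F x)).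
  by rewrite [LHS]surjective_pairing -[_.1]e.
apply: (continuous_pair _ cm).
exact: continuous_compose cs (@precomp_continuous _ _ _ _).
Qed.

End components.

(** * Composition, units and inverses of components *)

Section component_operations.
Variables G H : topological_groupoid.
Implicit Types psi phi chi : open_refinement G.

Local Notation fob psi phi := (fiber_ob (refinement_mor psi) (refinement_mor phi)).
Local Notation comp psi phi := (OFMor1_component H psi phi).

Section composition.
Variables (psi phi chi : open_refinement G).

(** The connecting arrow [z : w -> w'] gives [p(k, w') = p(k, w) z] and
[z q(w', v) = q(w, v)], where [z] is mapped to [H] by the common end of [p]
and [q]. *)
Lemma component_mul_via_indep (p : comp psi phi) (q : comp phi chi)
    (y : fob psi chi) (a a' : fob psi phi) (b b' : fob phi chi) :
  component_tgt p = component_src q -> via y a b -> via y a' b' ->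
  mul (component_map p a) (component_map q b) =
  mul (component_map p a') (component_map q b').
Proof.
move=> pq [a1 ab b2] [a1' ab' b2'].
have hP := groupoidP H; have kP := groupoidP (refinement_dom psi).
have vP := groupoidP (refinement_dom chi).
have [ps pt pn] := componentP p; have [qs qt qn] := componentP q.
have [_ _ uu _] := SMor0P (component_src p).
have [_ _ vu _] := SMor0P (component_tgt q).
have [_ _ psiu _] := SMor0P (refinement_mor psi).
have [_ _ chiu _] := SMor0P (refinement_mor chi).
have oa : on_ob (refinement_mor psi) (val a).1 =
  on_ob (refinement_mor phi) (val a).2 := set_mem (valP a).
have oa' : on_ob (refinement_mor psi) (val a').1 =
  on_ob (refinement_mor phi) (val a').2 := set_mem (valP a').
have ob_ : on_ob (refinement_mor phi) (val b).1 =
  on_ob (refinement_mor chi) (val b).2 := set_mem (valP b).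
have oww : on_ob (refinement_mor phi) (val a).2 =
  on_ob (refinement_mor phi) (val a').2 by rewrite -oa -oa' a1 a1'.
pose z := connecting_arr (fiber_pair oww).
have zs : src z = (val a).2 by exact: src_connecting_arr.
have zt : tgt z = (val a').2 by exact: tgt_connecting_arr.
have zo : on_arr (refinement_mor phi) z = unit (on_ob (refinement_mor phi) (val a).2).
  exact: connecting_arr_over.
have e1 : component_map p a' =
    mul (component_map p a) (on_arr (component_tgt p) z).
  rewrite -(pn a a' (unit (val a).1) z).
  - by rewrite uu a1 -a1' -ps (tg_mul1x hP).
  - exact: tg_src_unit kP _.
  - by rewrite (tg_tgt_unit kP) a1'.
  - exact: zs.
  - exact: zt.
  - by rewrite zo psiu oa.
have e2 : mul (on_arr (component_tgt p) z) (component_map q b') =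
    component_map q b.
  rewrite pq (qn b b' z (unit (val b).2)).
  - by rewrite vu -qt (tg_mulx1 hP).
  - by rewrite zs.
  - by rewrite zt.
  - exact: tg_src_unit vP _.
  - by rewrite (tg_tgt_unit vP) b2 b2'.
  - by rewrite zo chiu -ob_ ab.
have [ws wt _ _] := SMor0P (component_tgt p).
rewrite e1 -(tg_mulA hP) ?e2//.
  by rewrite pt ws zs.
by rewrite wt qs -pq -ab' zt.
Qed.

(** The intermediate object is chosen; [composite_mapE] frees formulas from the
choice. *)
Definition composite_map (p : comp psi phi) (q : comp phi chi)
    (y : ob (refinement_product psi chi)) : arr H :=
  let ab := sval (cid (exists_via phi y)) in
  mul (component_map p ab.1) (component_map q ab.2).

Variables (p : comp psi phi) (q : comp phi chi).
Hypothesis pq : component_tgt p = component_src q.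

Lemma composite_mapE (y : fob psi chi) (a : fob psi phi) (b : fob phi chi) :
  via y a b -> composite_map p q y = mul (component_map p a) (component_map q b).
Proof.
move=> yab; apply: (component_mul_via_indep pq _ yab).
exact: (svalP (cid (exists_via phi y))).
Qed.

Lemma component_composable (y : fob psi chi) (a : fob psi phi) (b : fob phi chi) :
  via y a b -> tgt (component_map p a) = src (component_map q b).
Proof.
have [_ pt _] := componentP p; have [qs _ _] := componentP q.
by move=> [_ ab _]; rewrite pt qs -pq ab.
Qed.

(** Fullness of [phi] lifts the image in [G] of an arrow of [K x_G V] to [W], and
the naturality squares of [p] and [q] over the lift are pasted. *)
Lemma composite_map_natural :
  component_natural (component_src p) (component_tgt q) (composite_map p q).
Proof.
have hP := groupoidP H.
have [ps pt pn] := componentP p; have [qs qt qn] := componentP q.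
have [_ ut _ _] := SMor0P (component_src p).
have [ws wt _ _] := SMor0P (component_tgt p).
have [vs _ _ _] := SMor0P (component_tgt q).
split.
- move=> y; have [[a b] /= yab] := exists_via phi y.
  rewrite (composite_mapE yab) (tg_src_mul hP); last exact: component_composable yab.
  by rewrite ps; case: yab => ->.
- move=> y; have [[a b] /= yab] := exists_via phi y.
  rewrite (composite_mapE yab) (tg_tgt_mul hP); last exact: component_composable yab.
  by rewrite qt; case: yab => _ _ ->.
- move=> y y' x z xy xy' zy zy' xz.
  have [[a b] /= yab] := exists_via phi y.
  have [[a' b'] /= yab'] := exists_via phi y'.
  rewrite (composite_mapE yab) (composite_mapE yab').
  have c := component_composable yab; have c' := component_composable yab'.
  case: yab yab' => [a1 ab b2] [a1' ab' b2'].
  have oa : on_ob (refinement_mor psi) (val a).1 =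
    on_ob (refinement_mor phi) (val a).2 := set_mem (valP a).
  have oa' : on_ob (refinement_mor psi) (val a').1 =
    on_ob (refinement_mor phi) (val a').2 := set_mem (valP a').
  have [psis psit _ _] := SMor0P (refinement_mor psi).
  have [fphi _ _] := refinementP phi.
  have [||w [wa wa' xw]] := fphi (val a).2 (val a').2 (on_arr (refinement_mor psi) x).
  + by rewrite psis xy -a1 oa.
  + by rewrite psit xy' -a1' oa'.
  have e1 : mul (on_arr (component_src p) x) (component_map p a') =
      mul (component_map p a) (on_arr (component_tgt p) w).
    by apply: pn; rewrite ?xy ?xy' ?a1 ?a1'.
  have e2 : mul (on_arr (component_tgt p) w) (component_map q b') =
      mul (component_map q b) (on_arr (component_tgt q) z).
    by rewrite pq; apply: qn; rewrite ?wa ?wa' ?zy ?zy' ?b2 ?b2' ?xw.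
  have cw : tgt (component_map p a) = src (on_arr (component_tgt p) w).
    by rewrite pt ws wa.
  have cw' : tgt (on_arr (component_tgt p) w) = src (component_map q b').
    by rewrite wt wa' -c' pt.
  rewrite (tg_mulA hP)//; last by rewrite ut ps xy' a1'.
  rewrite e1 -(tg_mulA hP)// e2 (tg_mulA hP)//.
  by rewrite qt vs zy b2.
Qed.

(** The chosen intermediate object need not vary continuously, but near each point
a choice that does computes the same map. *)
Lemma composite_map_continuous : continuous (composite_map p q).
Proof.
move=> y; have [N [s [t [Ny cs ct st]]]] := local_via phi y.
have cp : {within N, continuous (fun z => component_map p (s z))}.
  by move=> z; apply: continuous_comp; [exact: cs|exact: cts_fun].
have cq : {within N, continuous (fun z => component_map q (t z))}.
  by move=> z; apply: continuous_comp; [exact: ct|exact: cts_fun].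
have cpq := within_comp_within _ (within_pair cp cq)
  (tg_mul_continuous (groupoidP H)).
apply: (continuous_at_locally Ny (cpq _)) => z Nz.
  exact: (component_composable (st z Nz)).
by rewrite (composite_mapE (st z Nz)).
Qed.

Definition composite : comp psi chi :=
  mk_component (f := mkcts composite_map_continuous) composite_map_natural.

Lemma src_composite : component_src composite = component_src p.
Proof. exact: src_mk_component. Qed.

Lemma tgt_composite : component_tgt composite = component_tgt q.
Proof. exact: tgt_mk_component. Qed.

Lemma composite_eval (y : fob psi chi) (a : fob psi phi) (b : fob phi chi) :
  via y a b ->
  component_map composite y = mul (component_map p a) (component_map q b).
Proof.
by move=> yab; rewrite /composite map_mk_component; exact: composite_mapE.
Qed.

End composition.

Section composition_continuous.
Variables psi phi chi : open_refinement G.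

Definition composable_pairs : set (comp psi phi * comp phi chi) :=
  [set pq | component_tgt pq.1 = component_src pq.2].

Definition composite_of (pq : composable_pairs) : comp psi chi :=
  composite (set_mem (valP pq)).

(** On a small compact set [C] of pairs [(k, v)], maps [s] and [t] supplied by
[local_via] give compact sets [s @` C] and [t @` C], on which [p] and [q] are
controlled independently; continuity of the multiplication of [H] does the
rest. *)
Lemma composite_continuous : regular_space (ob G) -> continuous composite_of.
Proof.
move=> rG.
have c1 : continuous (fun pq : composable_pairs => (val pq).1).
  exact: continuous_compose (@continuous_val _ _) (@continuous_fst _ _).
have c2 : continuous (fun pq : composable_pairs => (val pq).2).
  exact: continuous_compose (@continuous_val _ _) (@continuous_snd _ _).
apply: (@continuous_into_component _ _ _ _ _ _
    (fun pq : composable_pairs => component_src (val pq).1)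
    (fun pq : composable_pairs => component_tgt (val pq).2)
    (fun pq : composable_pairs => component_map (composite_of pq))).
- by move=> r; exact: src_composite.
- by move=> r; exact: tgt_composite.
- by [].
- exact: continuous_compose c1 (@component_src_continuous _ _ _ _).
- exact: continuous_compose c2 (@component_tgt_continuous _ _ _ _).
apply: regular_compact_open_continuous; first exact: regular_refinement_product.
move=> pq y O oO Oy; have [N [s [t [Ny cs ct st]]]] := local_via phi y.
pose f (r : composable_pairs) z := component_map (val r).1 (s z).
pose g (r : composable_pairs) z := component_map (val r).2 (t z).
have compE r z : N z -> component_map (composite_of r) z = mul (f r z) (g r z).
  by move=> Nz; exact: (composite_eval (set_mem (valP r)) (st z Nz)).
have fgP r z : N z -> tgt (f r z) = src (g r z).
  by move=> Nz; exact: (component_composable (set_mem (valP r)) (st z Nz)).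
have Ny0 := nbhs_singleton Ny; rewrite (compE _ _ Ny0) in Oy.
have [[A B] [Af Bg] ABO] : nbhs (f pq y, g pq y)
    [set ab | tgt ab.1 = src ab.2 -> O (mul ab.1 ab.2)].
  have /subspace_continuousP mc := tg_mul_continuous (groupoidP H).
  apply: mc => /=; first exact: fgP.
  exact: open_nbhs_nbhs (conj oO Oy).
rewrite /= nbhsE in Af; rewrite /= nbhsE in Bg.
move: Af Bg => [A' [oA A'f] A'A] [B' [oB B'g] B'B].
have cm1 : continuous (fun r : composable_pairs => component_map (val r).1).
  exact: continuous_compose c1 (@component_map_continuous _ _ _ _).
have cm2 : continuous (fun r : composable_pairs => component_map (val r).2).
  exact: continuous_compose c2 (@component_map_continuous _ _ _ _).
have cf : {within N, continuous (f pq)}.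
  by move=> z; apply: continuous_comp; [exact: cs|exact: cts_fun].
have cg : {within N, continuous (g pq)}.
  by move=> z; apply: continuous_comp; [exact: ct|exact: cts_fun].
have NA : nbhs y [set z | N z -> A' (f pq z)].
  by move/subspace_continuousP : cf => /(_ y Ny0); apply; exact: open_nbhs_nbhs.
have NB : nbhs y [set z | N z -> B' (g pq z)].
  by move/subspace_continuousP : cg => /(_ y Ny0); apply; exact: open_nbhs_nbhs.
exists (N `&` ([set z | N z -> A' (f pq z)] `&` [set z | N z -> B' (g pq z)])).
  exact: filterI Ny (filterI NA NB).
move=> C cC CN.
have CN0 : C `<=` N by move=> z /CN[].
have csC : compact (s @` C).
  by apply: continuous_compact => //; exact: continuous_subspaceW cs.
have ctC : compact (t @` C).
  by apply: continuous_compact => //; exact: continuous_subspaceW ct.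
have fA : component_map (val pq).1 @` (s @` C) `<=` A'.
  by move=> _ [_ [z Cz <-] <-]; have [Nz [+ _]] := CN _ Cz; apply.
have gB : component_map (val pq).2 @` (t @` C) `<=` B'.
  by move=> _ [_ [z Cz <-] <-]; have [Nz [_ +]] := CN _ Cz; apply.
have near1 := cm1 pq _ (near_compact_open csC oA fA).
have near2 := cm2 pq _ (near_compact_open ctC oB gB).
have rO (r : composable_pairs) :
    component_map (val r).1 @` (s @` C) `<=` A' ->
    component_map (val r).2 @` (t @` C) `<=` B' ->
    component_map (composite_of r) @` C `<=` O.
  move=> rA rB _ [z Cz <-]; rewrite (compE _ _ (CN0 _ Cz)).
  apply: (ABO (f r z, g r z)); last exact: fgP (CN0 _ Cz).
  split; [apply/A'A/rA|apply/B'B/rB].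
    by exists (s z) => //; exists z.
  by exists (t z) => //; exists z.
exact: filterS2 rO near1 near2.
Qed.

End composition_continuous.

End component_operations.

Section component_laws.
Variables G H : topological_groupoid.
Implicit Types psi phi chi om : open_refinement G.

Local Notation fob psi phi := (fiber_ob (refinement_mor psi) (refinement_mor phi)).
Local Notation comp psi phi := (OFMor1_component H psi phi).

(** The map [(k, k') |-> u^1(k, 1, k')]. *)
Definition component_unit_map psi (u : SMor0 (refinement_dom psi) H) :
    continuousType (ob (refinement_product psi psi)) (arr H) :=
  on_arr u \o mkcts (@connecting_arr_continuous G psi).

(** Both sides of the square come from arrows of [K] with the same image in [G],
which faithfulness identifies. *)
Lemma component_unit_natural psi (u : SMor0 (refinement_dom psi) H) :
  component_natural u u (component_unit_map u).
Proof.
have [us ut _ um] := SMor0P u.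
have [ps pt pu pm] := SMor0P (refinement_mor psi).
have kP := groupoidP (refinement_dom psi); have gP := groupoidP G.
split; [by move=> a; rewrite us|by move=> a; rewrite ut|].
move=> a b x z xa xb za zb xz; rewrite /component_unit_map /mkcts /=.
have xb' : tgt x = src (connecting_arr b) by rewrite xb.
have az' : tgt (connecting_arr a) = src z by rewrite za.
rewrite -um// -um//; congr (on_arr u _).
have [_ fpsi _] := refinementP psi.
apply: fpsi.
- by rewrite (tg_src_mul kP)// (tg_src_mul kP)// xa.
- by rewrite (tg_tgt_mul kP)// (tg_tgt_mul kP)// zb.
- rewrite pm// pm// !connecting_arr_over -xb -pt (tg_mulx1 gP).
  by rewrite -xa -ps xz (tg_mul1x gP).
Qed.

Definition component_unit psi (u : SMor0 (refinement_dom psi) H) : comp psi psi :=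
  mk_component (component_unit_natural u).

Lemma component_unit_continuous psi : continuous (@component_unit psi).
Proof.
have cid_ : continuous (fun u : SMor0 (refinement_dom psi) H => u) by move=> ?.
apply: (@continuous_into_component _ _ _ _ _ _ _ _ _
  (fun u => src_mk_component (component_unit_natural u))
  (fun u => tgt_mk_component (component_unit_natural u))
  (fun u => map_mk_component (component_unit_natural u)) cid_ cid_).
apply: continuous_compose (@precompose_continuous _ _ _ _).
exact: continuous_compose (@continuous_val _ _) (@continuous_snd _ _).
Qed.

Definition fiber_swap psi phi (a : fob psi phi) : fob phi psi :=
  @fiber_pair _ _ _ (refinement_mor phi) (refinement_mor psi)
    (val a).2 (val a).1 (esym (set_mem (valP a))).

Lemma fiber_swap_continuous psi phi :
  continuous (@fiber_swap psi phi :
    ob (refinement_product psi phi) -> ob (refinement_product phi psi)).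
Proof.
apply: continuous_into; apply: continuous_pair.
  exact: fiber_proj2_ob_continuous.
exact: fiber_proj1_ob_continuous.
Qed.

(** The map [(w, k) |-> p(k, w)^-1]. *)
Definition component_inv_map psi phi (p : comp psi phi) :
    continuousType (ob (refinement_product phi psi)) (arr H) :=
  mkcts (tg_inv_continuous (groupoidP H)) \o
    (component_map p \o mkcts (@fiber_swap_continuous phi psi)).

Lemma component_inv_natural psi phi (p : comp psi phi) :
  component_natural (component_tgt p) (component_src p) (component_inv_map p).
Proof.
have hP := groupoidP H; have [ps pt pn] := componentP p.
have [us ut _ _] := SMor0P (component_src p).
have [ws wt _ _] := SMor0P (component_tgt p).
rewrite /component_inv_map /mkcts /=; split.
- by move=> a; rewrite (tg_src_inv hP) pt.
- by move=> a; rewrite (tg_tgt_inv hP) ps.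
move=> a b z x za zb xa xb zx.
have := pn (fiber_swap a) (fiber_swap b) x z xa xb za zb (esym zx).
set u := on_arr _ x; set w := on_arr _ z.
set B := component_map p (fiber_swap b).
set A := component_map p (fiber_swap a) => e.
change (mul w (inv B) = mul (inv A) u).
have uB : tgt u = src B by rewrite ut ps xb.
have Aw : tgt A = src w by rewrite ws pt za.
have uA : src u = src A by rewrite us ps xa.
have wB : tgt w = tgt B by rewrite wt pt zb.
have -> : w = mul (inv A) (mul u B).
  by rewrite e (tg_mulA hP) ?(tg_tgt_inv hP)// (tg_mulVx hP) Aw (tg_mul1x hP).
rewrite -(tg_mulA hP) ?(tg_tgt_inv hP) ?(tg_src_mul hP)//; last first.
  by rewrite (tg_tgt_mul hP)// (tg_src_inv hP).
rewrite -(tg_mulA hP)//; last by rewrite (tg_src_inv hP).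
by rewrite (tg_mulxV hP) -uB (tg_mulx1 hP).
Qed.

Definition component_inv psi phi (p : comp psi phi) : comp phi psi :=
  mk_component (component_inv_natural p).

Lemma component_inv_continuous psi phi : continuous (@component_inv psi phi).
Proof.
apply: (@continuous_into_component _ _ _ _ _ _ _ _ _
  (fun p => src_mk_component (component_inv_natural p))
  (fun p => tgt_mk_component (component_inv_natural p))
  (fun p => map_mk_component (component_inv_natural p))).
- exact: component_tgt_continuous.
- exact: component_src_continuous.
apply: continuous_compose (@postcompose_continuous _ _ _ _).
apply: continuous_compose (@precompose_continuous _ _ _ _).
exact: component_map_continuous.
Qed.

Lemma composite_unit_left psi phi (p : comp psi phi)
    (h : component_tgt (component_unit (component_src p)) = component_src p) :
  composite h = p.
Proof.
apply: component_ext => [||y]; [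
  by rewrite src_composite src_mk_component|exact: tgt_composite|].
have [ps _ _] := componentP p; have [_ _ uu _] := SMor0P (component_src p).
pose a : fob psi psi := fiber_pair (erefl (on_ob (refinement_mor psi) (val y).1)).
have yab : via y a y by [].
have -> : component_map (composite h) y =
  mul (component_map (component_unit (component_src p)) a) (component_map p y).
  exact: (composite_eval h yab).
have -> : component_map (component_unit (component_src p)) a =
    on_arr (component_src p) (unit (val y).1).
  by congr (on_arr _ _); exact: val_inj.
by rewrite uu -ps (tg_mul1x (groupoidP H)).
Qed.

Lemma composite_unit_right psi phi (p : comp psi phi)
    (h : component_tgt p = component_src (component_unit (component_tgt p))) :
  composite h = p.
Proof.
apply: component_ext => [||y]; [
  exact: src_composite|by rewrite tgt_composite tgt_mk_component|].
have [_ pt _] := componentP p; have [_ _ wu _] := SMor0P (component_tgt p).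
pose b : fob phi phi := fiber_pair (erefl (on_ob (refinement_mor phi) (val y).2)).
have yab : via y y b by [].
have -> : component_map (composite h) y =
  mul (component_map p y) (component_map (component_unit (component_tgt p)) b).
  exact: (composite_eval h yab).
have -> : component_map (component_unit (component_tgt p)) b =
    on_arr (component_tgt p) (unit (val y).2).
  by congr (on_arr _ _); exact: val_inj.
by rewrite wu -pt (tg_mulx1 (groupoidP H)).
Qed.

Lemma compositeA psi phi chi om (p : comp psi phi) (q : comp phi chi)
    (r : comp chi om) (pq : component_tgt p = component_src q)
    (qr : component_tgt q = component_src r)
    (pqr : component_tgt p = component_src (composite qr))
    (pqr' : component_tgt (composite pq) = component_src r) :
  composite pqr = composite pqr'.
Proof.
apply: component_ext => [||y]; [by rewrite !src_composite|by rewrite !tgt_composite|].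
have [[a b] /= yab] := exists_via phi y.
have [[c d] /= bcd] := exists_via chi b.
have oe : on_ob (refinement_mor psi) (val a).1 = on_ob (refinement_mor chi) (val d).1.
  have [_ ab _] := yab; have [bc cd _] := bcd.
  by rewrite (set_mem (valP a)) ab -bc (set_mem (valP c)) cd.
pose e : fob psi chi := fiber_pair oe.
have eac : via e a c.
  by have [_ ab _] := yab; have [bc cd _] := bcd; split => //; rewrite ab.
have yed : via y e d.
  by have [ay _ b_y] := yab; have [bc cd db] := bcd; split => //; rewrite db.
have -> : component_map (composite pqr) y =
    mul (component_map p a) (component_map (composite qr) b).
  exact: (composite_eval pqr yab).
have -> : component_map (composite qr) b =
    mul (component_map q c) (component_map r d).
  exact: (composite_eval qr bcd).
have -> : component_map (composite pqr') y =
    mul (component_map (composite pq) e) (component_map r d).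
  exact: (composite_eval pqr' yed).
have -> : component_map (composite pq) e =
    mul (component_map p a) (component_map q c).
  exact: (composite_eval pq eac).
apply: (tg_mulA (groupoidP H)).
  exact: (component_composable pq eac).
exact: (component_composable qr bcd).
Qed.

(** Naturality of [p] along the connecting arrow [k -> k'] and the identity of [w]
gives [u^1(k, 1, k') p(k', w) = p(k, w)]. *)
Lemma composite_inv_right psi phi (p : comp psi phi)
    (h : component_tgt p = component_src (component_inv p)) :
  composite h = component_unit (component_src p).
Proof.
apply: component_ext => [||y]; [
  by rewrite src_composite src_mk_component|
  by rewrite tgt_composite !tgt_mk_component|].
have hP := groupoidP H; have [ps pt pn] := componentP p.
have [_ _ wu _] := SMor0P (component_tgt p).
have [_ ut _ _] := SMor0P (component_src p).
have [_ _ phiu _] := SMor0P (refinement_mor phi).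
have fP := groupoidP (refinement_dom phi).
have [[a b] /= yab] := exists_via phi y.
have -> : component_map (composite h) y =
    mul (component_map p a) (inv (component_map p (fiber_swap b))).
  exact: (composite_eval h yab).
have [ay ab b_y] := yab.
have e : mul (on_arr (component_src p) (connecting_arr y))
    (component_map p (fiber_swap b)) = component_map p a.
  rewrite (pn a (fiber_swap b) (connecting_arr y) (unit (val a).2)).
  - by rewrite wu -pt (tg_mulx1 hP).
  - by rewrite ay.
  - by rewrite /= b_y.
  - exact: tg_src_unit fP _.
  - by rewrite (tg_tgt_unit fP) /= ab.
  - by rewrite connecting_arr_over phiu -ay (set_mem (valP a)).
have c : tgt (on_arr (component_src p) (connecting_arr y)) =
    src (component_map p (fiber_swap b)).
  by rewrite ut ps /= b_y.
rewrite -e -(tg_mulA hP)//; last by rewrite (tg_src_inv hP).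
by rewrite (tg_mulxV hP) -c (tg_mulx1 hP).
Qed.

(** Naturality of [p] along the identity of [k] and the connecting arrow [w -> w']
gives [p(k, w') = p(k, w) w^1(w, 1, w')]. *)
Lemma composite_inv_left psi phi (p : comp psi phi)
    (h : component_tgt (component_inv p) = component_src p) :
  composite h = component_unit (component_tgt p).
Proof.
apply: component_ext => [||y]; [
  by rewrite src_composite !src_mk_component|
  by rewrite tgt_composite tgt_mk_component|].
have hP := groupoidP H; have [ps pt pn] := componentP p.
have [_ _ uu _] := SMor0P (component_src p).
have [ws _ _ _] := SMor0P (component_tgt p).
have [_ _ psiu _] := SMor0P (refinement_mor psi).
have kP := groupoidP (refinement_dom psi).
have [[a b] /= yab] := exists_via psi y.
have -> : component_map (composite h) y =
    mul (inv (component_map p (fiber_swap a))) (component_map p b).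
  exact: (composite_eval h yab).
have [ay ab b_y] := yab.
have e : component_map p b = mul (component_map p (fiber_swap a))
    (on_arr (component_tgt p) (connecting_arr y)).
  rewrite -(pn (fiber_swap a) b (unit (val b).1) (connecting_arr y)).
  - by rewrite uu -ps (tg_mul1x hP).
  - by rewrite (tg_src_unit kP) /= ab.
  - exact: tg_tgt_unit kP _.
  - by rewrite /= ay.
  - by rewrite b_y.
  - by rewrite connecting_arr_over psiu -ay -ab (set_mem (valP a)).
have c : tgt (component_map p (fiber_swap a)) =
    src (on_arr (component_tgt p) (connecting_arr y)).
  by rewrite ws pt /= ay.
rewrite e (tg_mulA hP)//; last by rewrite (tg_tgt_inv hP).
by rewrite (tg_mulVx hP) c (tg_mul1x hP).
Qed.

End component_laws.

(** * The groupoid of generalized morphisms *)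

Section OFMor_groupoid.
Variables G H : topological_groupoid.
Implicit Types psi phi chi : open_refinement G.

Local Notation comp psi phi := (OFMor1_component H psi phi).

(** Off the composable pairs the value is a default. *)
Definition OFMor_comp psi phi chi (p : comp psi phi) (q : comp phi chi) :
    OFMor1 G H :=
  if pselect (component_tgt p = component_src q) is left pq
  then OFMor_arr (composite pq) else OFMor_arr p.

(** The middle refinements of [p] and [q] are only propositionally equal, so [p] is
transported before composing. *)
Definition OFMor_mul (p q : OFMor1 G H) : OFMor1 G H :=
  if pselect ((projT1 p).2 = (projT1 q).1) is left e
  then OFMor_comp
    (eq_rect _ (fun phi => comp (projT1 p).1 phi) (projT2 p) _ e) (projT2 q)
  else p.

Definition OFMor_unit (u : OFMor0 G H) : OFMor1 G H :=
  OFMor_arr (component_unit (projT2 u)).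

Definition OFMor_inv (p : OFMor1 G H) : OFMor1 G H :=
  OFMor_arr (component_inv (projT2 p)).

Lemma OFMor_mulE psi phi chi (p : comp psi phi) (q : comp phi chi)
    (pq : component_tgt p = component_src q) :
  OFMor_mul (OFMor_arr p) (OFMor_arr q) = OFMor_arr (composite pq).
Proof.
rewrite /OFMor_mul; case: pselect => [e|//].
rewrite (Prop_irrelevance e erefl) [eq_rect _ _ _ _ _]/= /OFMor_comp.
by case: pselect => [pq'|//]; rewrite (Prop_irrelevance pq' pq).
Qed.

Lemma OFMor_composableE psi phi chi (p : comp psi phi) (q : comp phi chi) :
  OFMor_tgt (OFMor_arr p) = OFMor_src (OFMor_arr q) ->
  component_tgt p = component_src q.
Proof. exact: existT_inj2. Qed.

(** Composable pairs share their middle refinement, which can thus be assumed to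
be the same term. *)
Lemma OFMor_composable_ind (P : OFMor1 G H -> OFMor1 G H -> Prop) :
  (forall psi phi chi (p : comp psi phi) (q : comp phi chi),
     component_tgt p = component_src q -> P (OFMor_arr p) (OFMor_arr q)) ->
  forall p q, OFMor_tgt p = OFMor_src q -> P p q.
Proof.
move=> IP [[psi phi] p] [[phi' chi] q] pq.
have e : phi = phi' := existT_inj1 pq.
by subst phi'; exact: IP (OFMor_composableE pq).
Qed.

Lemma OFMor_src_comp psi phi chi (p : comp psi phi) (q : comp phi chi)
    (pq : component_tgt p = component_src q) :
  OFMor_src (OFMor_arr (composite pq)) = OFMor_src (OFMor_arr p).
Proof. exact: congr1 (src_composite pq). Qed.

Lemma OFMor_tgt_comp psi phi chi (p : comp psi phi) (q : comp phi chi)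
    (pq : component_tgt p = component_src q) :
  OFMor_tgt (OFMor_arr (composite pq)) = OFMor_tgt (OFMor_arr q).
Proof. exact: congr1 (tgt_composite pq). Qed.

Lemma OFMor_mul_composition : is_OFMor_composition OFMor_mul.
Proof.
move=> psi phi chi p q pq; exists (composite pq); first exact: OFMor_mulE.
by move=> k v w hkv hkw hwv; exact: composite_eval.
Qed.

Lemma OFMor_src_continuous : continuous (@OFMor_src G H).
Proof. by move=> [[psi phi] p] U /component_src_continuous. Qed.

Lemma OFMor_tgt_continuous : continuous (@OFMor_tgt G H).
Proof. by move=> [[psi phi] p] U /component_tgt_continuous. Qed.

Lemma OFMor_unit_continuous : continuous OFMor_unit.
Proof. by move=> [psi u] U /component_unit_continuous. Qed.

Lemma OFMor_inv_continuous : continuous OFMor_inv.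
Proof. by move=> [[psi phi] p] U /component_inv_continuous. Qed.

(** Components are open in [OFMor1], so neighbourhoods of a composable pair may be
taken inside the product of two components. *)
Lemma OFMor_mul_continuous : regular_space (ob G) ->
  {within [set p : OFMor1 G H * OFMor1 G H | OFMor_tgt p.1 = OFMor_src p.2],
    continuous (fun p => OFMor_mul p.1 p.2)}.
Proof.
move=> rG; apply/subspace_continuousP => -[p0 q0] pq0.
have {pq0} : OFMor_tgt p0 = OFMor_src q0 := pq0.
move: p0 q0; apply: OFMor_composable_ind => psi phi chi p q pq U.
rewrite [X in nbhs X](OFMor_mulE pq) => nU.
pose x : @composable_pairs G H psi phi chi := exist _ (p, q) (mem_set pq).
have xE : composite_of x = composite pq by congr composite; exact: Prop_irrelevance.
have : nbhs (composite_of x) [set r | U (OFMor_arr r)] by rewrite xE.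
move=> /(composite_continuous rG)[_ [[W oW <-] Wx WU]].
have [[P Q] [Pp Qq] PQW] := open_nbhs_nbhs (conj oW Wx : open_nbhs (p, q) W).
exists ([set OFMor_arr r | r in P], [set OFMor_arr r | r in Q]).
  by split; exact: existT_nbhs.
move=> [a b] [[p' Pp' ea] [q' Qq' eb]].
have <- : OFMor_arr p' = a := ea; have <- : OFMor_arr q' = b := eb.
move=> /OFMor_composableE pq'.
pose y : @composable_pairs G H psi phi chi := exist _ (p', q') (mem_set pq').
change (U (OFMor_mul (OFMor_arr p') (OFMor_arr q'))).
have -> : OFMor_mul (OFMor_arr p') (OFMor_arr q') = OFMor_arr (composite_of y).
  exact: OFMor_mulE.
by apply: (WU y); exact: PQW.
Qed.

Lemma OFMor_groupoid : regular_space (ob G) ->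
  is_topological_groupoid (@OFMor_src G H) (@OFMor_tgt G H)
    OFMor_mul OFMor_unit OFMor_inv.
Proof.
move=> rG; split.
- apply: OFMor_composable_ind => psi phi chi p q pq.
  by rewrite (OFMor_mulE pq); exact: OFMor_src_comp.
- apply: OFMor_composable_ind => psi phi chi p q pq.
  by rewrite (OFMor_mulE pq); exact: OFMor_tgt_comp.
- move=> p q r pq; move: p q pq r.
  apply: OFMor_composable_ind => psi phi chi p q pq [[chi' om] r] qr.
  have e : chi = chi' := existT_inj1 qr; subst chi'.
  have {}qr := OFMor_composableE qr.
  have pqr : component_tgt p = component_src (composite qr).
    by rewrite src_composite.
  have pqr' : component_tgt (composite pq) = component_src r.
    by rewrite tgt_composite.
  rewrite (OFMor_mulE qr) (OFMor_mulE pqr) (OFMor_mulE pq).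
  rewrite [RHS](OFMor_mulE pqr').
  by congr OFMor_arr; exact: compositeA.
- by move=> [psi u]; exact: congr1 (src_mk_component (component_unit_natural u)).
- by move=> [psi u]; exact: congr1 (tgt_mk_component (component_unit_natural u)).
- move=> [[psi phi] p].
  have h : component_tgt (component_unit (component_src p)) = component_src p.
    exact: tgt_mk_component.
  rewrite [LHS](OFMor_mulE h); congr OFMor_arr; exact: composite_unit_left.
- move=> [[psi phi] p].
  have h : component_tgt p = component_src (component_unit (component_tgt p)).
    exact: esym (src_mk_component _).
  rewrite [LHS](OFMor_mulE h); congr OFMor_arr; exact: composite_unit_right.
- by move=> [[psi phi] p]; exact: congr1 (src_mk_component (component_inv_natural p)).
- by move=> [[psi phi] p]; exact: congr1 (tgt_mk_component (component_inv_natural p)).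
- move=> [[psi phi] p].
  have h : component_tgt p = component_src (component_inv p).
    exact: esym (src_mk_component _).
  rewrite [LHS](OFMor_mulE h); congr OFMor_arr; exact: composite_inv_right.
- move=> [[psi phi] p].
  have h : component_tgt (component_inv p) = component_src p.
    exact: tgt_mk_component.
  rewrite [LHS](OFMor_mulE h); congr OFMor_arr; exact: composite_inv_left.
- exact: OFMor_src_continuous.
- exact: OFMor_tgt_continuous.
- exact: OFMor_mul_continuous.
- exact: OFMor_unit_continuous.
- exact: OFMor_inv_continuous.
Qed.

End OFMor_groupoid.

Theorem theoremA2 (G H : topological_groupoid) (hG : regular_space (ob G)) :
  exists (m : OFMor1 G H -> OFMor1 G H -> OFMor1 G H)
         (e : OFMor0 G H -> OFMor1 G H) (i : OFMor1 G H -> OFMor1 G H),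
    is_OFMor_composition m /\
    is_topological_groupoid (@OFMor_src G H) (@OFMor_tgt G H) m e i.
Proof.
exists (@OFMor_mul G H), (@OFMor_unit G H), (@OFMor_inv G H).
by split; [exact: OFMor_mul_composition|exact: OFMor_groupoid].
Qed.
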